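(* The languages recognized by MM-1gQFA with bounded error are exactly the regular languages. That is, for every finite alphabet $\Sigma$ and every language $L\subseteq\Sigma^*$, $L$ is regular if and only if there exist an MM-1gQFA $\mathcal{M}$ over $\Sigma$ and an $\epsilon>0$ such that $\mathcal{M}$ recognizes $L$ with bounded error $\epsilon$.
   Context: For a finite-dimensional complex Hilbert space $\mathcal{H}$, let $L(\mathcal{H})$ be the set of linear operators on $\mathcal{H}$. A density operator is a positive semidefinite operator of trace $1$; the support $\mathrm{supp}(A)$ of a positive operator $A$ is the span of its eigenvectors with nonzero eigenvalue. A trace-preserving quantum operation acting on $\mathcal{H}$ is a map $\mathcal{E}:L(\mathcal{H})\to L(\mathcal{H})$ of the form $\mathcal{E}(\rho)=\sum_k E_k\rho E_k^\dagger$ (finite sum) with $\sum_k E_k^\dagger E_k=I$. A measure-many one-way general quantum finite automaton (MM-1gQFA) is a tuple $\mathcal{M}=\{\mathcal{H},\Sigma,\rho_0,\{\mathcal{E}_\sigma\}_{\sigma\in\Sigma\cup\{\triangleright,\$\}},\mathcal{H}_{acc},\mathcal{H}_{rej}\}$ where $\mathcal{H}$ is a finite-dimensional Hilbert space, $\Sigma$ is a finite input alphabet, $\triangleright,\$\notin\Sigma$ are the left and right end-markers, each $\mathcal{E}_\sigma$ is a trace-preserving quantum operation acting on $\mathcal{H}$, $\mathcal{H}_{acc},\mathcal{H}_{rej}$ are subspaces of $\mathcal{H}$ which together with another subspace $\mathcal{H}_{non}$ give an orthogonal decomposition $\mathcal{H}=\mathcal{H}_{acc}\oplus\mathcal{H}_{rej}\oplus\mathcal{H}_{non}$,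 and $\rho_0$ (the initial state) is a density operator on $\mathcal{H}$ with $\mathrm{supp}(\rho_0)\subseteq\mathcal{H}_{non}$. $P_{non},P_{acc},P_{rej}$ denote the orthogonal projectors onto $\mathcal{H}_{non},\mathcal{H}_{acc},\mathcal{H}_{rej}$. On input $x\in\Sigma^*$ the machine reads $\triangleright x\$$. Its total state is a triple $(\rho,p_{acc},p_{rej})\in L(\mathcal{H})\times\mathbb{R}\times\mathbb{R}$, starting at $(\rho_0,0,0)$, and reading a symbol $\sigma$ transforms it by $$(\rho,p_{acc},p_{rej})\mapsto\big(P_{non}\mathcal{E}_\sigma(\rho)P_{non},\ \mathrm{Tr}(P_{acc}\mathcal{E}_\sigma(\rho))+p_{acc},\ \mathrm{Tr}(P_{rej}\mathcal{E}_\sigma(\rho))+p_{rej}\big).$$ The accepting probability $f_{\mathcal{M}}(x)$ is the component $p_{acc}$ after all of $\triangleright x\$$ has been read. A language $L\subseteq\Sigma^*$ is recognized by $\mathcal{M}$ with bounded error $\epsilon$ ($\epsilon>0$) if for some $\lambda\in(0,1]$, $f_{\mathcal{M}}(x)\ge\lambda+\epsilon$ for every $x\in L$ and $f_{\mathcal{M}}(y)\le\lambda-\epsilon$ for every $y\in\Sigma^*\setminus L$. A language is regular if it is accepted by a (deterministic) finite automaton. *)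

(* Defs.v *)
From HB Require Import structures.
From mathcomp Require Import all_boot all_order all_algebra.
From mathcomp Require Import sesquilinear spectral.
From mathcomp Require Import complex reals.

Set Implicit Arguments.
Unset Strict Implicit.
Unset Printing Implicit Defensive.

Import Order.TTheory GRing.Theory Num.Theory.
Local Open Scope ring_scope.
Local Open Scope sesquilinear_scope.

(* The n-dimensional Hilbert space is the space 'cV[R[i]]_n of column vectors
   with inner product <u, v> = u^t* *m v, where ^t* is the conjugate transpose;
   its linear operators are the matrices 'M[R[i]]_n, acting by A *m v. *)

Section HilbertSpace.
Variables (R : realType) (n : nat).
Local Notation C := R[i].
Implicit Types (A P rho : 'M[C]_n) (u v w : 'cV[C]_n) (U V W : {vspace 'cV[C]_n}).

Definition dotc u v : C := (u^t* *m v) 0 0.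

Definition orthv U V : Prop :=
  forall u v, u \in U -> v \in V -> dotc u v = 0.

Definition orth_decomposition U V W : Prop :=
  [/\ orthv U V, orthv U W, orthv V W & (U + V + W)%VS = fullv].

(* proj_ortho works with row spaces; it is given the conjugate transposes of a
   basis of V, and since an orthogonal projector is Hermitian, the matrix
   it returns is also the projector for the action on columns (orthprojP). *)
Definition orthproj V : 'M[C]_n :=
  proj_ortho (\matrix_(i < \dim V) ((vbasis V)`_i)^t*).

(* 0 <= z in R[i] means that z is real and nonnegative. *)
Definition psd A : Prop := forall v, 0 <= dotc v (A *m v).

Definition density rho : Prop := psd rho /\ \tr rho = 1.

(* supp A v: v is in the span of the eigenvectors of A with nonzero
   eigenvalue. *)
Definition supp A v : Prop :=
  exists2 s : seq 'cV[C]_n,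
    forall u, u \in s -> exists2 a : C, a != 0 & A *m u = a *: u
    & v \in <<s>>%VS.

Definition tp_quantum_operation (E : 'M[C]_n -> 'M[C]_n) : Prop :=
  exists (m : nat) (K : 'I_m -> 'M[C]_n),
    (forall rho, E rho = \sum_(k < m) K k *m rho *m (K k)^t*) /\
    \sum_(k < m) (K k)^t* *m K k = 1%:M.

Lemma orthprojP V v :
  orthproj V *m v \in V /\
  (forall w, w \in V -> dotc w (v - orthproj V *m v) = 0).
Proof.
set U : 'M[C]_(\dim V, n) := \matrix_(i < \dim V) ((vbasis V)`_i)^t*.
have UE (D : 'rV[C]_(\dim V)) :
    (D *m U)^t* = \sum_i (D 0 i)^* *: (vbasis V)`_i.
  apply/colP => j; rewrite !mxE summxE rmorph_sum.
  by apply: eq_bigr => i _; rewrite !mxE rmorphM /= conjCK.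
have PU : (orthproj V <= U)%MS by rewrite /orthproj proj_orthoE.
have PN : (1%:M - orthproj V) *m (orthproj V)^t* = 0.
  apply/orthomx1P; apply: (submx_trans (B := orthomx Num.conj
    (mx_of_hermitian (hermitian1mx _)) U)).
    by rewrite -[X in _ - X]mul1mx; exact: proj_ortho_compl_sub.
  by rewrite submx_ortho.
have PE : orthproj V = orthproj V *m (orthproj V)^t*.
  move/eqP: PN; rewrite mulmxBl mul1mx subr_eq0 => /eqP PN.
  by rewrite -[LHS]trmxCK {1}PN trmx_mul map_mxM trmxCK.
have PH : (orthproj V)^t* = orthproj V.
  by rewrite {1}PE trmx_mul map_mxM trmxCK -PE.
split.
  have /submxP[D PvE] : ((orthproj V *m v)^t* <= U)%MS.
    by rewrite trmx_mul map_mxM PH mulmx_sub.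
  rewrite -[_ *m v]trmxCK PvE UE; apply: rpred_sum => i _.
  by rewrite memvZ // vbasis_mem // mem_nth // size_tuple.
move=> w wV; rewrite /dotc mulmxBr mulmxA.
suff wU : (w^t* <= U)%MS by rewrite (proj_ortho_id wU) subrr mxE.
have -> : w = ((\row_i (coord (vbasis V) i w)^*) *m U)^t*.
  rewrite UE {1}(coord_vbasis wV).
  by apply: eq_bigr => i _; rewrite mxE conjCK.
by rewrite trmxCK submxMl.
Qed.

End HilbertSpace.

Inductive tape_symbol (Sigma : Type) : Type :=
  | LeftMarker
  | Letter of Sigma
  | RightMarker.
Arguments LeftMarker {Sigma}.
Arguments RightMarker {Sigma}.

Record mm1gqfa (R : realType) (Sigma : finType) := MM1gQFA {
  dimH : nat;
  rho0 : 'M[R[i]]_dimH;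
  qop : tape_symbol Sigma -> 'M[R[i]]_dimH -> 'M[R[i]]_dimH;
  Hacc : {vspace 'cV[R[i]]_dimH};
  Hrej : {vspace 'cV[R[i]]_dimH};
  Hnon : {vspace 'cV[R[i]]_dimH};
  qop_tp : forall s, tp_quantum_operation (qop s);
  H_decomposition : orth_decomposition Hacc Hrej Hnon;
  rho0_density : density rho0;
  rho0_supp : forall v, supp rho0 v -> v \in Hnon
}.

Section Semantics.
Variables (R : realType) (Sigma : finType) (M : mm1gqfa R Sigma).

Definition total_state : Type := 'M[R[i]]_(dimH M) * R * R.

(* The traces are real (the operators involved are positive); complex.Re only
   casts them from R[i] to R. *)
Definition step (st : total_state) (s : tape_symbol Sigma) : total_state :=
  let: (rho, pacc, prej) := st in
  let rho' := qop s rho in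
  (orthproj (Hnon M) *m rho' *m orthproj (Hnon M),
   complex.Re (\tr (orthproj (Hacc M) *m rho')) + pacc,
   complex.Re (\tr (orthproj (Hrej M) *m rho')) + prej).

Definition run (x : seq Sigma) : total_state :=
  foldl step (rho0 M, 0, 0)
    (LeftMarker :: rcons [seq Letter a | a <- x] RightMarker).

Definition accept_prob (x : seq Sigma) : R := (run x).1.2.

Definition recognizes_with_error (L : seq Sigma -> Prop) (eps : R) : Prop :=
  exists lambda : R,
    [/\ 0 < lambda <= 1,
        forall x, L x -> accept_prob x >= lambda + eps
      & forall y, ~ L y -> accept_prob y <= lambda - eps].

End Semantics.

Record dfa (Sigma : finType) := DFA {
  dfa_state : finType;
  dfa_init : dfa_state;
  dfa_final : {set dfa_state};
  dfa_trans : dfa_state -> Sigma -> dfa_state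
}.

Definition dfa_accepts (Sigma : finType) (A : dfa Sigma) (x : seq Sigma) : bool :=
  foldl (@dfa_trans _ A) (dfa_init A) x \in dfa_final A.

Definition regular (Sigma : finType) (L : seq Sigma -> Prop) : Prop :=
  exists A : dfa Sigma, forall x, L x <-> dfa_accepts A x.

(* Main.v *)
(* A word x is read into a subnormalized state rho_x with accumulated accepting
   probability p_x.  In the Heisenberg picture the rest z$ of the tape acts by
   an effect 0 <= A_z <= 1, and f(xz) = p_x + Tr(A_z rho_x).  The entries of
   rho_x and of A_z are bounded independently of x and z, so words whose
   (p_x, rho_x) fall into the same cell of a fine enough grid have continuations
   with acceptance probabilities less than 2 eps apart, hence are Nerode
   equivalent: there are finitely many classes.  Conversely, a DFA is simulated
   on a basis of classical states by the channels with Kraus operators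
   |f(k)><k|. *)

Require Import Defs.
From mathcomp Require Import all_boot all_order all_algebra.
From mathcomp Require Import boolp sesquilinear spectral ring lra.
From mathcomp Require Import complex reals.
Set Implicit Arguments.
Unset Strict Implicit.
Import Order.TTheory GRing.Theory Num.Theory.
Local Open Scope ring_scope.
Local Open Scope sesquilinear_scope.

(** * Nerode classes *)

(** The colouring [c] need not be compatible with appending letters, so each transition replaces the
    current word by a chosen representative of its class and appends the letter there. Every such
    replacement preserves membership under all continuations. *)
Lemma finite_index_regular {Sigma F : finType} (L : seq Sigma -> Prop)
    (c : seq Sigma -> F) :
  (forall x y z, c x = c y -> L (x ++ z) -> L (y ++ z)) -> regular L.
Proof.
move=> cL.
have [rep repP] : exists rep : F -> seq Sigma, forall x, c (rep (c x)) = c x.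
  have [q|rep repP] := @choice F (seq Sigma)
    (fun q y => forall x, c x = q -> c y = q); last by exists rep => x; exact: repP.
  have [[x cx]|nx] := pselect (exists x, c x = q); first by exists x.
  by exists [::] => x cx; case: nx; exists x.
pose A := @DFA Sigma F (c [::]) [set q | `[< L (rep q) >]]
  (fun q a => c (rcons (rep q) a)).
(* Quantifying over the suffix [z] lets the induction move the last letter of the prefix into the
   suffix. *)
have Nerode x z :
    L (x ++ z) <-> L (rep (foldl (@dfa_trans _ A) (dfa_init A) x) ++ z).
  elim/last_ind: x z => [|x a IH] z.
    by split; apply: cL; rewrite /= repP.
  rewrite foldl_rcons -cats1 -catA IH catA cats1.
  by split; apply: cL; rewrite /= repP.
exists A => x; rewrite -[x in L x]cats0 Nerode cats0 /dfa_accepts inE.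
by split => [/asboolP|/asboolP].
Qed.

Lemma finite_net {R : realType} (B d : R) : 0 < d ->
  exists (F : finType) (q : R -> F), forall a b,
    `|a| <= B -> `|b| <= B -> q a = q b -> `|a - b| <= d.
Proof.
(* [t a] numbers the cell of length [d], counted from [-B], that contains [a]. *)
move=> d0; pose t a := Num.truncn ((a + B) / d).
exists 'I_(Num.truncn ((B + B) / d)).+1, (fun a => inord (t a)).
have tP a : `|a| <= B -> [/\ (t a <= Num.truncn ((B + B) / d))%N,
    (t a)%:R * d <= a + B & a + B < (t a).+1%:R * d].
  rewrite ler_norml => /andP[Ba aB].
  have : 0 <= (a + B) / d by rewrite divr_ge0 ?(ltW d0) // -lerBlDr sub0r.
  move=> /truncn_itv /andP[]; rewrite ler_pdivlMr // ltr_pdivrMr //.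
  by split=> //; rewrite le_truncn // ler_pM2r ?invr_gt0 // lerD2r.
move=> a b /tP[ta la ua] /tP[tb lb ub] /(congr1 val).
rewrite /= !inordK ?ltnS // => tab.
move: la ua lb ub; rewrite tab -natr1 mulrDl mul1r ler_norml.
move: (_ * d) => m *; apply/andP; split; lra.
Qed.

(** Prefixes whose coordinates share their cells get values at most [eps] apart on every
    continuation, while members and non-members of [L] are at least [2 * eps] apart. *)
Lemma bounded_factorization_regular {R : realType} {Sigma K : finType}
    (L : seq Sigma -> Prop) (f : seq Sigma -> R) (u v : seq Sigma -> K -> R)
    (B lambda eps : R) :
  (forall x k, `|u x k| <= B) -> (forall z k, `|v z k| <= B) ->
  (forall x z, f (x ++ z) = \sum_k u x k * v z k) ->
  0 < eps -> (forall x, L x -> lambda + eps <= f x) ->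
  (forall x, ~ L x -> f x <= lambda - eps) -> regular L.
Proof.
move=> uB vB fE e0 Lf nLf.
have K0 : 0 <= `|B| *+ #|K| by rewrite mulrn_wge0.
(* The pairing over [K] changes by at most [d] times the product in this denominator; the [+ 1]
   keeps the denominator positive when that product is 0. *)
pose d := eps / (`|B| *+ #|K| + 1).
have d0 : 0 < d by rewrite divr_gt0 // ltr_wpDl.
have [F [q qP]] := finite_net B d0.
apply: (@finite_index_regular _ _ _ (fun x => [ffun k => q (u x k)])).
move=> x y z /ffunP cxy Lxz; have [//|/nLf fy] := pselect (L (y ++ z)).
have fx := Lf _ Lxz.
suff : `|f (x ++ z) - f (y ++ z)| <= eps by rewrite ler_norml => /andP[_]; lra.
rewrite !fE -sumrB; apply: (le_trans (ler_norm_sum _ _ _)).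
apply: (@le_trans _ _ (\sum_(k : K) d * `|B|)).
  apply: ler_sum => k _; rewrite -mulrBl normrM ler_pM //.
    by apply: qP => //; have := cxy k; rewrite !ffunE.
  exact: le_trans (ler_norm _).
rewrite sumr_const -mulrnAr -[leRHS](@divfK _ (`|B| *+ #|K| + 1)).
  by rewrite -/d ler_pM2l // ler_wpDr.
by rewrite gt_eqF // ltr_wpDl.
Qed.

(** * Positive operators and orthogonal projectors *)

Lemma ctrmxM {C : numClosedFieldType} {m n p} (A : 'M[C]_(m, n)) (B : 'M[C]_(n, p)) :
  (A *m B)^t* = B^t* *m A^t*.
Proof. by rewrite trmx_mul map_mxM. Qed.

Section Operators.
Context {R : realType} {n : nat}.
Local Notation C := R[i].
Implicit Types (A P rho : 'M[C]_n) (u v w : 'cV[C]_n) (U V W : {vspace 'cV[C]_n}).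

Lemma dotcE u v : dotc u v = \sum_i (u i 0)^* * v i 0.
Proof. by rewrite /dotc !mxE; apply: eq_bigr => i _; rewrite !mxE. Qed.

Lemma dotcC u v : dotc u v = (dotc v u)^*.
Proof.
rewrite !dotcE rmorph_sum; apply: eq_bigr => i _.
by rewrite rmorphM /= conjCK mulrC.
Qed.

Lemma dotcDr u v w : dotc u (v + w) = dotc u v + dotc u w.
Proof. by rewrite /dotc mulmxDr mxE. Qed.

Lemma dotcBr u v w : dotc u (v - w) = dotc u v - dotc u w.
Proof. by rewrite /dotc mulmxBr !mxE. Qed.

Lemma dotcZr c u v : dotc u (c *: v) = c * dotc u v.
Proof. by rewrite /dotc -scalemxAr mxE. Qed.

Lemma dotc0r u : dotc u 0 = 0.
Proof. by rewrite /dotc mulmx0 mxE. Qed.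

Lemma dotc_mulmxl A u v : dotc (A *m u) v = dotc u (A^t* *m v).
Proof. by rewrite /dotc ctrmxM mulmxA. Qed.

Lemma dotcDl u v w : dotc (u + v) w = dotc u w + dotc v w.
Proof. by rewrite !(dotcC _ w) dotcDr rmorphD. Qed.

Lemma dotcZl c u v : dotc (c *: u) v = c^* * dotc u v.
Proof. by rewrite !(dotcC _ v) dotcZr rmorphM. Qed.

Lemma dotc_ge0 v : 0 <= dotc v v.
Proof. by rewrite dotcE sumr_ge0 // => i _; rewrite mulrC mul_conjC_ge0. Qed.

Lemma dotc_eq0 v : dotc v v = 0 -> v = 0.
Proof.
rewrite dotcE => /eqP; rewrite psumr_eq0 => [/allP v0|i _]; last first.
  by rewrite mulrC mul_conjC_ge0.
apply/colP => i; rewrite mxE; apply/eqP.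
by have := v0 i (mem_index_enum i); rewrite mulrC mul_conjC_eq0.
Qed.

Lemma dotc_delta A i j : dotc (delta_mx i 0) (A *m delta_mx j 0) = A i j.
Proof.
rewrite /dotc trmx_delta map_delta_mx mulmxA -rowE -colE.
by rewrite !mxE.
Qed.

Lemma mulmx_dotc0 A : (forall u v, dotc u (A *m v) = 0) -> A = 0.
Proof. by move=> A0; apply/matrixP => i j; rewrite -dotc_delta A0 mxE. Qed.

(** The difference of two candidates for the projection lies in [V] and is orthogonal to [V], hence
    to itself. *)
Lemma orthproj_uniq V v w : w \in V ->
  (forall u, u \in V -> dotc u (v - w) = 0) -> orthproj V *m v = w.
Proof.
move=> wV vw; have [PvV vPv] := orthprojP V v.
apply/eqP; rewrite -subr_eq0; apply/eqP/dotc_eq0.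
have {2}-> : orthproj V *m v - w = (v - w) - (v - orthproj V *m v).
  by rewrite opprB [RHS]addrC subrKA.
by rewrite dotcBr vw ?vPv ?subr0 // memvB.
Qed.

Lemma orthproj_id V v : v \in V -> orthproj V *m v = v.
Proof. by move=> vV; apply: orthproj_uniq => // u _; rewrite subrr dotc0r. Qed.

Lemma orthproj_idem V : orthproj V *m orthproj V = orthproj V.
Proof.
apply/eqP; rewrite -subr_eq0; apply/eqP/mulmx_dotc0 => u v.
rewrite mulmxBl -mulmxA (orthproj_id (orthprojP V v).1) subrr dotc0r //.
Qed.

Lemma orthproj_herm V : (orthproj V)^t* = orthproj V.
Proof.
set P := orthproj V.
(* The residual [v - P *m v] is orthogonal to [P *m u]; the resulting product [P^t* *m P] is
   self-adjoint. *)
have PE : P^t* = P^t* *m P.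
  apply/eqP; rewrite -subr_eq0; apply/eqP/mulmx_dotc0 => u v.
  have [PuV _] := orthprojP V u; have [_ /(_ _ PuV)] := orthprojP V v.
  by rewrite dotc_mulmxl mulmxBr mulmxBl mulmxA.
by rewrite PE -{2}[P]trmxCK -ctrmxM -PE trmxCK.
Qed.

Lemma orthv_sym U V : orthv U V -> orthv V U.
Proof. by move=> UV u v uV vU; rewrite dotcC UV // rmorph0. Qed.

Lemma orthproj_decomposition U V W : orth_decomposition U V W ->
  orthproj U + orthproj V + orthproj W = 1%:M.
Proof.
case=> UV UW VW UVW; apply/eqP; rewrite -subr_eq0; apply/eqP/mulmx_dotc0 => u x.
have /memv_addP[y /memv_addP[a aU [b bV ->]] [c cW ->]] : x \in (U + V + W)%VS.
  by rewrite UVW memvf.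
have Ua : orthproj U *m (a + b + c) = a.
  apply: orthproj_uniq => // w wU.
  by rewrite -(addrA a) (addrC a) addrK dotcDr (UV w b) ?(UW w c) ?addr0.
have Vb : orthproj V *m (a + b + c) = b.
  apply: orthproj_uniq => // w wV.
  by rewrite (addrC a) -(addrA b) (addrC b) addrK dotcDr (orthv_sym UV) ?(VW w c) ?addr0.
have Wc : orthproj W *m (a + b + c) = c.
  apply: orthproj_uniq => // w wW.
  by rewrite addrK dotcDr (orthv_sym UW) ?(orthv_sym VW) ?addr0.
by rewrite mulmxBl mul1mx 2!mulmxDl Ua Vb Wc subrr dotc0r.
Qed.

Lemma psdD A B : psd A -> psd B -> psd (A + B).
Proof. by move=> hA hB v; rewrite mulmxDl dotcDr addr_ge0. Qed.

Lemma psd_sum (I : finType) (F : I -> 'M[C]_n) :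
  (forall i, psd (F i)) -> psd (\sum_i F i).
Proof.
move=> hF; elim/big_ind: _ => // [v|A B]; last exact: psdD.
by rewrite mul0mx dotc0r.
Qed.

Lemma psd_congr A (B : 'M[C]_n) : psd A -> psd (B *m A *m B^t*).
Proof.
move=> hA v; have := hA (B^t* *m v).
by rewrite dotc_mulmxl trmxCK !mulmxA.
Qed.

Lemma psd1 : psd (1%:M : 'M[C]_n).
Proof. by move=> v; rewrite mul1mx dotc_ge0. Qed.

Lemma psd_orthproj_congr V A : psd A -> psd (orthproj V *m A *m orthproj V).
Proof. by move=> /(@psd_congr _ (orthproj V)); rewrite orthproj_herm. Qed.

Lemma psd_orthproj V : psd (orthproj V).
Proof.
by have := psd_orthproj_congr V psd1; rewrite mulmx1 orthproj_idem.
Qed.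

Lemma psd_diag_ge0 A i : psd A -> 0 <= A i i.
Proof. by move=> /(_ (delta_mx i 0)); rewrite dotc_delta. Qed.

Lemma psd_trace_ge0 A : psd A -> 0 <= \tr A.
Proof. by move=> hA; apply: sumr_ge0 => i _; apply: psd_diag_ge0. Qed.

Lemma mxtrace_orthproj V A :
  \tr (orthproj V *m A) = \tr (orthproj V *m A *m orthproj V).
Proof. by rewrite [in RHS]mxtrace_mulC mulmxA orthproj_idem. Qed.

(* Polarization at [e_i + c e_j] for the four units [c = 1, -1, 'i, -'i]. *)
Lemma psd_entry_le A i j : psd A -> `|A i j| <= A i i + A j j.
Proof.
move=> hA.
have form (c : C) : `|c| = 1 -> 0 <= A i i + A j j + (c * A i j + c^* * A j i).
  move=> c1; have := hA (delta_mx i 0 + c *: delta_mx j 0).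
  rewrite mulmxDr -scalemxAr !(dotcDl, dotcDr, dotcZl, dotcZr) !dotc_delta.
  rewrite mulrDr mulrA [c^* * c]mulrC -normCK c1 expr1n mul1r.
  by rewrite [c^* * _ + _]addrC addrACA.
have D0 : A i i + A j j \is Num.real by rewrite realD ?ger0_real ?psd_diag_ge0.
have bound c : `|c| = 1 -> `|c * A i j + c^* * A j i| <= A i i + A j j.
  move=> c1; have h1 := form c c1; have := form (- c).
  rewrite normrN c1 rmorphN !mulNr -opprD => /(_ erefl) h2.
  have r : c * A i j + c^* * A j i \is Num.real.
    by rewrite -[X in X \is _](addKr (A i i + A j j)) realD ?realN // ger0_real.
  rewrite real_ler_norml //; apply/andP; split; rewrite -subr_ge0 //.
  by rewrite opprK addrC.
have b1 := bound 1 (normr1 _); have b2 := bound 'i (normCi _).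
rewrite -(@ler_pM2l _ 2) ?ltr0n // -[X in X * `|_|](normr_nat _ 2) -normrM.
(* The cross terms for [c = 1] and [c = 'i] are combined so that the contributions of [A j i]
   cancel. *)
have -> : 2 * A i j = (1 * A i j + 1^* * A j i) - 'i * ('i * A i j + 'i^* * A j i).
  rewrite rmorph1 conjCi mulrDr !mulrA mulrN -expr2 sqrCi opprK; ring.
apply: (le_trans (ler_normB _ _)); rewrite normrM normCi [1 * `|_|]mul1r mulr_natl mulr2n.
exact: lerD.
Qed.

End Operators.

(** * Bounded error implies regularity *)

Section Soundness.
Context {R : realType} {Sigma : finType} (M : mm1gqfa R Sigma).
Local Notation C := R[i].
Local Notation Pacc := (orthproj (Hacc M)).
Local Notation Prej := (orthproj (Hrej M)).
Local Notation Pnon := (orthproj (Hnon M)).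
Local Notation op := 'M[C]_(dimH M).
Implicit Types (A rho : op) (w : seq (tape_symbol Sigma)).

Lemma projectors_sum1 : Pacc + Prej + Pnon = 1%:M.
Proof. exact: orthproj_decomposition (H_decomposition M). Qed.

(* Heisenberg picture: the effect of reading [s] pulled back through the Kraus
   operators of [qop s] and the intermediate measurement. *)
Lemma step_adjoint s A : psd A -> psd (1%:M - A) ->
  exists A' : op, [/\ psd A', psd (1%:M - A') & forall rho,
    \tr (A' *m rho) =
    \tr (Pacc *m qop s rho) + \tr (A *m (Pnon *m qop s rho *m Pnon))].
Proof.
move=> A_ge0 A_le1; have [m [K [KE K1]]] := qop_tp M s.
pose X := Pacc + Pnon *m A *m Pnon.
(* The complement of [X] has the same shape, with rejection in place of acceptance and [1%:M - A] in
   place of [A], so it is positive for the same reason. *)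
have X_le1 : 1%:M - X = Prej + Pnon *m (1%:M - A) *m Pnon.
  have cancel (V : zmodType) (a b c d : V) : a + b + c - (a + d) = b + (c - d).
    by rewrite opprD addrA -(addrA a) (addrC a) addrK addrA.
  by rewrite mulmxBr mulmxBl mulmx1 orthproj_idem -projectors_sum1 cancel.
have pull Y : psd Y -> psd (\sum_(k < m) (K k)^t* *m Y *m K k).
  move=> hY; apply: psd_sum => k.
  by have := psd_congr ((K k)^t*) hY; rewrite trmxCK.
exists (\sum_(k < m) (K k)^t* *m X *m K k); split.
- by apply: pull; apply: psdD; [exact: psd_orthproj|exact: psd_orthproj_congr].
- have -> : 1%:M - \sum_(k < m) (K k)^t* *m X *m K k =
      \sum_(k < m) (K k)^t* *m (1%:M - X) *m K k.
    rewrite -K1 -sumrB; apply: eq_bigr => k _.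
    by rewrite K1 mulmxBr mulmx1 mulmxBl.
  rewrite X_le1; apply: pull; apply: psdD; first exact: psd_orthproj.
  exact: psd_orthproj_congr.
move=> rho.
have -> : \tr (A *m (Pnon *m qop s rho *m Pnon)) = \tr (Pnon *m A *m Pnon *m qop s rho).
  by rewrite mulmxA mxtrace_mulC !mulmxA.
rewrite -mxtraceD -mulmxDl -/X KE mulmx_suml mulmx_sumr !raddf_sum.
apply: eq_bigr => k _ /=.
by rewrite -!mulmxA [LHS]mxtrace_mulC !mulmxA.
Qed.

(** Effects are built from the right end of the tape, starting from 0 on the empty tape. The effect
    is fixed before the state, so it depends on the remaining tape alone. *)
Lemma run_effect w : exists A : op, [/\ psd A, psd (1%:M - A) & forall st,
  (foldl (@step _ _ M) st w).1.2 = st.1.2 + complex.Re (\tr (A *m st.1.1))].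
Proof.
elim: w => [|s w [A [A_ge0 A_le1 AE]]].
  exists 0; split => [v||[[rho p] r]] /=; first by rewrite mul0mx dotc0r.
    by rewrite subr0; exact: psd1.
  by rewrite mul0mx mxtrace0 addr0.
have [A' [A'_ge0 A'_le1 A'E]] := step_adjoint s A_ge0 A_le1.
exists A'; split => // -[[rho p] r].
by rewrite /= AE /= A'E raddfD /= addrCA addrA [X in _ = X]addrC addrC.
Qed.

(** The trace is the probability of not having halted; the slack in the inequality leaves room for
    the probability of rejection. *)
Definition substate (st : total_state M) : Prop :=
  [/\ psd st.1.1, 0 <= st.1.2 & st.1.2%:C%C + \tr st.1.1 <= 1].

(** [qop s] preserves the trace, which the three projectors then split; dropping the nonnegative
    rejecting share gives the inequality. *)
Lemma step_substate st s : substate st -> substate (step st s).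
Proof.
case: st => -[rho p] r [/= rho_ge0 p0 le1].
have [m [K [KE K1]]] := qop_tp M s.
have rho'_ge0 : psd (qop s rho).
  by rewrite KE; apply: psd_sum => k; exact: psd_congr.
have rho'_tr : \tr (qop s rho) = \tr rho.
  rewrite KE raddf_sum /=.
  under eq_bigr => k _ do rewrite -mulmxA mxtrace_mulC -mulmxA.
  by rewrite -raddf_sum -mulmx_sumr K1 mulmx1.
have tr_ge0 V : 0 <= \tr (orthproj V *m qop s rho).
  by rewrite mxtrace_orthproj; apply: psd_trace_ge0; apply: psd_orthproj_congr.
(* A nonnegative complex number is real, so the cast to [R] loses nothing. *)
have ReE V : (complex.Re (\tr (orthproj V *m qop s rho)))%:C%C =
    \tr (orthproj V *m qop s rho).
  by rewrite RRe_real // ger0_real.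
split => /=; first exact: psd_orthproj_congr.
  by rewrite addr_ge0 // -ler0c ReE.
rewrite rmorphD /= ReE -mxtrace_orthproj; apply: le_trans le1.
rewrite -rho'_tr -[in leRHS](mul1mx (qop s rho)) -projectors_sum1.
have monotone (a b c q : C) : 0 <= b -> a + q + c <= q + (a + b + c).
  by move=> b0; rewrite (addrC a) -!addrA !lerD2l lerDr.
rewrite !mulmxDl !mxtraceD; exact: monotone.
Qed.

Lemma foldl_substate w st : substate st -> substate (foldl (@step _ _ M) st w).
Proof. by elim: w st => //= s w IH st hst; apply: IH; exact: step_substate. Qed.

Lemma init_substate : substate (rho0 M, 0, 0).
Proof. by have [h1 h2] := rho0_density M; split=> //=; rewrite h2 add0r. Qed.

End Soundness.

Lemma normRe_le {R : realType} (z : R[i]) (b : R) : `|z| <= b%:C%C ->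
  `|complex.Re z| <= b.
Proof. by move=> h; rewrite -lecR; exact: le_trans (normc_ge_Re z) h. Qed.

Lemma normIm_le {R : realType} (z : R[i]) (b : R) : `|z| <= b%:C%C ->
  `|complex.Im z| <= b.
Proof.
move=> h; rewrite -[complex.Im z]opprK -ReiNIm normrN; apply: normRe_le.
by rewrite normrM (@normCi R[i]) mulr1.
Qed.

Lemma Re_mul {R : realType} (a b : R[i]) : complex.Re (a * b) =
  complex.Re a * complex.Re b - complex.Im a * complex.Im b.
Proof. by case: a b => [? ?] [? ?]. Qed.

Lemma bounded_error_regular {R : realType} {Sigma : finType}
    (M : mm1gqfa R Sigma) (L : seq Sigma -> Prop) (eps : R) :
  0 < eps -> recognizes_with_error M L eps -> regular L.
Proof.
move=> e0 [lambda [_ Lf nLf]].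
have [A AP] := choice (fun z : seq Sigma =>
  run_effect M (rcons [seq Letter a | a <- z] RightMarker)).
(* The left marker is read with the prefix and the right marker with the suffix, so [st x] does not
   depend on the continuation. *)
pose st x := foldl (@step _ _ M) (rho0 M, 0, 0)
  (LeftMarker :: [seq Letter a | a <- x]).
have stP x : substate (st x) by apply: foldl_substate; exact: init_substate.
have fE x z : accept_prob M (x ++ z) =
    (st x).1.2 + complex.Re (\tr (A z *m (st x).1.1)).
  rewrite /accept_prob /run map_cat rcons_cat -cat_cons foldl_cat.
  by have [_ _ ->] := AP z.
have trE B (rho : 'M[R[i]]_(dimH M)) : complex.Re (\tr (B *m rho)) =
    \sum_(k : 'I_(dimH M) * 'I_(dimH M)) complex.Re (rho k.2 k.1) * complex.Re (B k.1 k.2)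
  + \sum_(k : 'I_(dimH M) * 'I_(dimH M)) - complex.Im (rho k.2 k.1) * complex.Im (B k.1 k.2).
  rewrite -big_split /= /mxtrace raddf_sum /=.
  rewrite -(pair_bigA _ (fun i j => complex.Re (rho j i) * complex.Re (B i j)
     + - complex.Im (rho j i) * complex.Im (B i j))) /=.
  apply: eq_bigr => i _; rewrite mxE raddf_sum /=; apply: eq_bigr => j _.
  by rewrite Re_mul mulrC mulNr [complex.Im _ * _]mulrC.
(* Real and imaginary parts of the entries turn the complex trace into a real pairing; the [unit]
   index pairs the accumulated probability with the constant 1. *)
pose ix : finType := ('I_(dimH M) * 'I_(dimH M) + 'I_(dimH M) * 'I_(dimH M) + unit)%type.
pose u x (k : ix) := match k with
  | inl (inl k) => complex.Re ((st x).1.1 k.2 k.1)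
  | inl (inr k) => - complex.Im ((st x).1.1 k.2 k.1)
  | inr _ => (st x).1.2 end.
pose v z (k : ix) := match k with
  | inl (inl k) => complex.Re (A z k.1 k.2)
  | inl (inr k) => complex.Im (A z k.1 k.2)
  | inr _ => 1 : R end.
(* The bound 2 comes from [psd_entry_le]: diagonal entries are at most 1, for states by the trace
   and for effects by positivity of the complement. *)
apply: (@bounded_factorization_regular _ _ ix L (accept_prob M) u v 2 lambda eps) => //.
- have ub x i j : `|(st x).1.1 i j| <= (2 : R)%:C%C.
    have [rho0 p0 le1] := stP x; apply: le_trans (psd_entry_le i j rho0) _.
    have tr1 : \tr (st x).1.1 <= 1.
      by apply: le_trans le1; rewrite lerDr ler0c.
    have d1 k : (st x).1.1 k k <= 1.
      apply: le_trans tr1; rewrite /mxtrace (bigD1 k) //= lerDl sumr_ge0 // => l _.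
      exact: psd_diag_ge0.
    by rewrite rmorphD rmorph1 lerD.
  move=> x [[k|k]|k] /=; first by apply: normRe_le.
    by rewrite normrN; apply: normIm_le.
  have [rho0 p0 le1] := stP x; rewrite ger0_norm // -lecR.
  apply: (@le_trans _ _ 1); last by rewrite rmorphD rmorph1 lerDl ler01.
  by apply: le_trans le1; rewrite lerDl psd_trace_ge0.
- have vb z i j : `|A z i j| <= (2 : R)%:C%C.
    have [A0 A1 _] := AP z; apply: le_trans (psd_entry_le i j A0) _.
    have d1 k : A z k k <= 1.
      by have := psd_diag_ge0 k A1; rewrite !mxE eqxx subr_ge0.
    by rewrite rmorphD rmorph1 lerD.
  move=> z [[k|k]|k] /=; first exact: normRe_le.
    exact: normIm_le.
  by rewrite normr1 ler1n.
- move=> x z; rewrite fE trE !big_sumType /= addrC; congr (_ + _).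
  by rewrite big_const card_unit /= addr0 mulr1.
Qed.

(** * Simulation of a DFA *)

Section ClassicalOperation.
Context {R : realType} {n : nat}.
Local Notation C := R[i].

Definition mask (S : pred 'I_n) : 'M[C]_n := diag_mx (\row_i (S i)%:R).

(** The span of the basis vectors indexed by [S], encoded as a kernel so that membership means
    vanishing of the other coordinates. *)
Definition coordspace (S : pred 'I_n) : {vspace 'cV[C]_n} :=
  lker (linfun (mulmx (mask (predC S)))).

Lemma mask_mulE S (v : 'cV[C]_n) i j : (mask S *m v) i j = (S i)%:R * v i j.
Proof. by rewrite mul_diag_mx !mxE. Qed.

Lemma mem_coordspace S (v : 'cV[C]_n) :
  reflect (forall i, ~~ S i -> v i 0 = 0) (v \in coordspace S).
Proof.
rewrite memv_ker lfunE /=; apply: (iffP eqP) => [v0 i Si|v0].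
  by have /colP/(_ i) := v0; rewrite mask_mulE mxE /= Si mul1r.
apply/colP => i; rewrite mask_mulE mxE /=.
by case: (boolP (S i)) => [_|/v0 ->]; rewrite ?mul0r ?mulr0.
Qed.

Lemma orthproj_coordspace S : orthproj (coordspace S) = mask S.
Proof.
apply/eqP; rewrite -subr_eq0; apply/eqP/mulmx_dotc0 => u v.
rewrite mulmxBl (@orthproj_uniq _ _ _ v (mask S *m v)) ?subrr ?dotc0r //.
  by apply/mem_coordspace => i /negPf Si; rewrite mask_mulE Si mul0r.
move=> w /mem_coordspace w0; rewrite dotcE big1 // => i _.
rewrite mxE [X in _ + X]mxE mask_mulE.
by case: (boolP (S i)) => [|/w0 ->]; rewrite ?mul1r ?subrr ?mulr0 // rmorph0 mul0r.
Qed.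

Lemma orthv_coordspace (S S' : pred 'I_n) : (forall i, S i -> ~~ S' i) ->
  orthv (coordspace S) (coordspace S').
Proof.
move=> SS' u v /mem_coordspace u0 /mem_coordspace v0.
rewrite dotcE big1 // => i _; case: (boolP (S i)) => [/SS'/v0 ->|/u0 ->].
  by rewrite mulr0.
by rewrite rmorph0 mul0r.
Qed.

(** The numerical hypothesis says that exactly one predicate holds at each index, so the three masks
    sum to the identity. *)
Lemma coordspace_decomposition (S1 S2 S3 : pred 'I_n) :
  (forall i, S1 i + S2 i + S3 i = 1)%N ->
  orth_decomposition (coordspace S1) (coordspace S2) (coordspace S3).
Proof.
move=> S1E; split.
- by apply: orthv_coordspace => i; have := S1E i; case: (S1 i) (S2 i) (S3 i) => [] [] [].
- by apply: orthv_coordspace => i; have := S1E i; case: (S1 i) (S2 i) (S3 i) => [] [] [].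
- by apply: orthv_coordspace => i; have := S1E i; case: (S1 i) (S2 i) (S3 i) => [] [] [].
apply/eqP; rewrite eqEsubv subvf /=; apply/subvP => v _.
have -> : v = mask S1 *m v + mask S2 *m v + mask S3 *m v.
  apply/colP => i; rewrite mxE [X in X + _]mxE !mask_mulE -!mulrDl -!natrD.
  by rewrite S1E mul1r.
by rewrite !memv_add //; apply/mem_coordspace => i /negPf Si;
  rewrite mask_mulE Si mul0r.
Qed.

Lemma mask_delta S q : mask S *m delta_mx q q = (S q)%:R *: delta_mx q q.
Proof.
apply/matrixP => i j; rewrite mul_diag_mx !mxE.
by case: (altP (i =P q)) => [->|]; rewrite ?mulr0.
Qed.

Lemma delta_mask S q : delta_mx q q *m mask S = (S q)%:R *: delta_mx q q.
Proof.
apply/matrixP => i j; rewrite mul_mx_diag !mxE mulrC.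
by case: (altP (j =P q)) => [->|]; rewrite ?andbF ?mulr0.
Qed.

Lemma ctrmx_delta m p (i : 'I_m) (j : 'I_p) :
  (delta_mx i j : 'M[C]_(m, p))^t* = delta_mx j i.
Proof. by rewrite trmx_delta map_delta_mx. Qed.

Definition classical_op (f : 'I_n -> 'I_n) (rho : 'M[C]_n) : 'M[C]_n :=
  \sum_(k < n) delta_mx (f k) k *m rho *m (delta_mx (f k) k)^t*.

(** Each Kraus operator contributes the projector onto the [k]-th basis vector whatever [f k] is, so
    [f] may merge states. *)
Lemma classical_op_tp f : tp_quantum_operation (classical_op f).
Proof.
exists n, (fun k => delta_mx (f k) k); split=> //.
rewrite [RHS]scalar_mx_sum_delta; apply: eq_bigr => k _.
by rewrite ctrmx_delta mul_delta_mx scale1r.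
Qed.

Lemma classical_op_delta f q :
  classical_op f (delta_mx q q) = delta_mx (f q) (f q).
Proof.
rewrite /classical_op (bigD1 q) //= big1 => [|k kq].
  by rewrite addr0 ctrmx_delta !mul_delta_mx.
by rewrite mul_delta_mx_0 ?mul0mx.
Qed.

Lemma density_delta q : density (delta_mx q q : 'M[C]_n).
Proof.
split; last first.
  rewrite /mxtrace (bigD1 q) //= mxE eqxx big1 ?addr0 // => i iq.
  by rewrite mxE (negPf iq).
have := psd_congr (delta_mx q q) (@psd1 R n).
by rewrite mulmx1 ctrmx_delta mul_delta_mx.
Qed.

Lemma measure_delta S q :
  orthproj (coordspace S) *m delta_mx q q *m orthproj (coordspace S) =
  (S q)%:R *: delta_mx q q.
Proof.
rewrite orthproj_coordspace mask_delta -scalemxAl delta_mask scalerA.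
by rewrite -natrM mulnb andbb.
Qed.

Lemma Re_prob_delta S q :
  complex.Re (\tr (orthproj (coordspace S) *m delta_mx q q)) = (S q)%:R :> R.
Proof.
rewrite orthproj_coordspace mask_delta mxtraceZ (density_delta q).2 mulr1.
by case: (S q).
Qed.

(** An eigenvector [u] with eigenvalue [a] satisfies [a * u i 0 = 0] for [i] other than [q], so a
    nonzero [a] confines it to the [q]-th axis. *)
Lemma supp_delta (S : pred 'I_n) q v : S q ->
  supp (delta_mx q q : 'M[C]_n) v -> v \in coordspace S.
Proof.
move=> Sq [s sP]; apply/subvP/span_subvP => u /sP[a a0 /colP ua].
apply/mem_coordspace => i Si; have /eqP := ua i; rewrite [X in _ == X]mxE.
have iq : (i == q) = false by apply: contraNF Si => /eqP ->.
rewrite mxE big1 => [|k _]; last by rewrite mxE iq mul0r.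
by rewrite eq_sym mulf_eq0 (negPf a0) => /eqP.
Qed.

End ClassicalOperation.

(** * The quantum automaton of a DFA *)

Section Completeness.
Variables (R : realType) (Sigma : finType) (D : dfa Sigma).

(* Basis states: [inl q] is the DFA state [q]; [inr true] and [inr false] span
   the accepting and rejecting subspaces. *)
Definition basis : finType := (dfa_state D + bool)%type.

(** Only the right marker leads into halting states, so no probability is absorbed before the whole
    word is read. *)
Definition basis_step (s : tape_symbol Sigma) (t : basis) : basis :=
  match s, t with
  | Letter a, inl q => inl (dfa_trans q a)
  | RightMarker, inl q => inr (q \in dfa_final D)
  | _, _ => t
  end.

(** Indexing the three outcomes by [option bool] makes the subspaces partition the basis by
    construction. *)
Definition halting (h : option bool) (i : 'I_#|basis|) : bool :=
  (if enum_val i is inr b then Some b else None) == h.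

Definition mm_op (s : tape_symbol Sigma) : 'M[R[i]]_#|basis| -> 'M[R[i]]_#|basis| :=
  classical_op (fun i => enum_rank (basis_step s (enum_val i))).

Lemma halting_decomposition : orth_decomposition
  (coordspace (R := R) (halting (Some true)))
  (coordspace (halting (Some false))) (coordspace (halting None)).
Proof.
by apply: coordspace_decomposition => i; rewrite /halting; case: (enum_val i) => [|[]].
Qed.

Lemma halting_rank h t : halting h (enum_rank t) =
  ((if t is inr b then Some b else None) == h).
Proof. by rewrite /halting enum_rankK. Qed.

Definition mm_of_dfa : mm1gqfa R Sigma.
Proof.
refine (@MM1gQFA R Sigma #|basis|
  (delta_mx (enum_rank (inl (dfa_init D) : basis)) (enum_rank (inl (dfa_init D) : basis)))
  mm_op _ _ _ _ halting_decomposition (density_delta _) _).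
- by move=> s; exact: classical_op_tp.
- by move=> v; apply: supp_delta; rewrite halting_rank.
Defined.

Local Arguments step : simpl never.

(** A basis state is sent to a basis state, on which the measurement outcome is certain; the
    remaining operator is 0 once a halting state is reached. *)
Lemma step_basis t p r s :
  let b h := halting h (enum_rank (basis_step s t)) in
  @step R Sigma mm_of_dfa (delta_mx (enum_rank t) (enum_rank t), p, r) s =
  ((b None)%:R *: delta_mx (enum_rank (basis_step s t)) (enum_rank (basis_step s t)),
   (b (Some true))%:R + p, (b (Some false))%:R + r).
Proof.
pose Proj h := orthproj (coordspace (R := R) (halting h)).
have -> : @step R Sigma mm_of_dfa (delta_mx (enum_rank t) (enum_rank t), p, r) s =
    (let rho := mm_op s (delta_mx (enum_rank t) (enum_rank t)) in
     (Proj None *m rho *m Proj None, complex.Re (\tr (Proj (Some true) *m rho)) + p,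
      complex.Re (\tr (Proj (Some false) *m rho)) + r)) by [].
rewrite /mm_op classical_op_delta enum_rankK.
exact: (f_equal3 (fun a b c => (a, b + p, c + r)) (measure_delta _ _)
  (Re_prob_delta _ _) (Re_prob_delta _ _)).
Qed.

Lemma accept_prob_mm_of_dfa x : accept_prob mm_of_dfa x = (dfa_accepts D x)%:R.
Proof.
rewrite /accept_prob /run -rcons_cons foldl_rcons.
(* Before the right marker the machine sits in the basis state of the current DFA state, with
   nothing yet accepted or rejected. *)
have -> : foldl (@step _ _ mm_of_dfa) (rho0 mm_of_dfa, 0, 0)
    (LeftMarker :: [seq Letter a | a <- x]) =
    (let q := enum_rank (inl (foldl (@dfa_trans _ D) (dfa_init D) x) : basis) in
     (delta_mx q q, 0, 0)).
  elim/last_ind: x => [|x a IH].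
    by rewrite /= step_basis !halting_rank /= scale1r addr0.
  rewrite map_rcons -rcons_cons foldl_rcons IH step_basis !halting_rank /=.
  by rewrite scale1r addr0 foldl_rcons.
rewrite step_basis !halting_rank /= addr0 /dfa_accepts.
by case: (_ \in _).
Qed.

End Completeness.

Unset Implicit Arguments.

Theorem theorem17 (R : realType) (Sigma : finType) (L : seq Sigma -> Prop) :
  regular L <->
  exists (M : mm1gqfa R Sigma) (eps : R),
    0 < eps /\ recognizes_with_error M L eps.
Proof.
split=> [[D LD]|[M [eps [e0]]]]; last exact: bounded_error_regular.
have half : 2^-1 + 2^-1 = 1 :> R by rewrite -div1r -splitr.
(* The acceptance probability is 0 or 1, so cut point and error 1/2 put the two thresholds exactly
   at 1 and 0. *)
exists (mm_of_dfa R D), 2^-1; split; first by rewrite invr_gt0 ltr0n.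
exists 2^-1; split.
- by rewrite invr_gt0 ltr0n invf_le1 ?ltr0n // ler1n.
- by move=> x /LD Dx; rewrite accept_prob_mm_of_dfa Dx half.
- move=> x nLx; rewrite accept_prob_mm_of_dfa.
  have -> : dfa_accepts D x = false by apply/negP => /LD.
  by rewrite subrr.
Qed.
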